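(* Let $\mathcal A$ be a timed automaton game and $\Phi$ an objective. For all $\varepsilon>0$ and $\rho\ge0$, $$\mathrm{JRWinTimeDiv}_1^{\mathcal A,\varepsilon,\rho}(\Phi)\subseteq\mathrm{RobWinTimeDiv}_1^{\mathcal A}(\Phi)\subseteq\mathrm{WinTimeDiv}_1^{\mathcal A}(\Phi).$$ Moreover, all these inclusions are strict in general (there exist timed automaton games and objectives for which they are proper inclusions).
   Context: A timed automaton game is $\mathcal{A}=\langle L,C,A_1,A_2,E,\gamma\rangle$: $L$ finite locations; $C$ finite clocks; $A_1,A_2$ disjoint finite action sets of players 1 and 2 (not containing $\bot_1,\bot_2,\bot_*$); $E$ a set of edges $\langle l,a,\varphi,l',\lambda\rangle$ with guard $\varphi$ a clock constraint built from atoms $x\le d$, $d\le x$ ($d\in\mathbb N$) with negation and conjunction, reset set $\lambda\subseteq C$; distinct edges from a location carry distinct actions; $\gamma$ assigns invariants. States are $\langle l,\kappa\rangle$, $\kappa:C\to\mathbb R_{\ge0}$, $\kappa\models\gamma(l)$. At $s=\langle l,\kappa\rangle$ player $i$'s moves $\Gamma_i(s)$: $\langle\Delta,\bot_i\rangle$ if $\kappa+\Delta'\models\gamma(l)$ for all $0\le\Delta'\le\Delta$; $\langle\Delta,a_i\rangle$ ($a_i\in A_i$) if moreover an $a_i$-edge from $l$ has its guard satisfied by $\kappa+\Delta$; for player 1 also $\langle0,\bot_*\rangle$. $\delta(s,\langle\Delta,\bot_*\rangle)=s$, $\delta(\langle l,\kappa\rangle,\langle\Delta,\bot_i\rangle)=\langle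 l,\kappa+\Delta\rangle$, $\delta(\langle l,\kappa\rangle,\langle\Delta,a_i\rangle)=\langle l',(\kappa+\Delta)[\lambda:=0]\rangle$. For $m_1=\langle\Delta_1,a_1\rangle$, $m_2=\langle\Delta_2,a_2\rangle$: $\delta_{jd}(s,m_1,m_2)=\{\delta(s,m_1)\}$ if $\Delta_1<\Delta_2$, $a_1\ne\bot_*$; $\{\delta(s,m_2)\}$ if $\Delta_2<\Delta_1$ or $a_1=\bot_*$; both if $\Delta_1=\Delta_2$, $a_1\ne\bot_*$; elapsed time is $\min(\Delta_1,\Delta_2)$ if $a_1\ne\bot_*$, else $\Delta_2$. Player 1 is blamed for $s\to s'$ iff $a_1\ne\bot_*$, $\Delta_1\le\Delta_2$, $\delta(s,m_1)=s'$; player 2 iff ($\Delta_2\le\Delta_1$ and $\delta(s,m_2)=s'$) or $a_1=\bot_*$. An objective is a set of runs. A run is time-divergent if its total elapsed time is infinite; it is in $\mathrm{Blameless}_i$ if player $i$ is blamed finitely often. Strategies map finite run prefixes to available moves; $\pi_i$ is receptive if against every opponent strategy from every state every outcome is time-divergent or in $\mathrm{Blameless}_i$. $\mathrm{WinTimeDiv}_1^{\mathcal A}(\Phi)$: states from which player 1 has a receptive strategy all of whose outcomes against every receptive player-2 strategy lie in $\Phi$. Limit-robust: at $s$, a limit-robust move of player 1 is either a move $\langle\Delta,\bot_*\rangle\in\Gamma_1(s)$ or $\langle[\alpha,\beta],a_1\rangle$ with $0\le\alpha<\beta$ and $\langle\Delta,a_1\rangle\in\Gamma_1(s)$ for all $\Delta\in[\alpha,\beta]$;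 against $m_2$, its possible outcomes are $\delta_{jd}(s,m_1,m_2)$ for $m_1=\langle\Delta,\bot_*\rangle$ in the first case, or $m_1=\langle\Delta,a_1\rangle$ with any $\Delta\in[\alpha,\beta]$ in the second. A limit-robust strategy assigns limit-robust moves to prefixes; it is receptive if all its outcomes against all player-2 strategies from all states are time-divergent or in $\mathrm{Blameless}_1$. $\mathrm{RobWinTimeDiv}_1^{\mathcal A}(\Phi)$: states from which player 1 has a receptive limit-robust strategy all of whose outcomes against every receptive player-2 strategy lie in $\Phi$. Jitter/response: for $m=\langle\Delta,a\rangle$, $e\ge0$, let $m+e=\langle\Delta+e,a\rangle$. A player-1 strategy $\pi_1$ is compatible for $\varepsilon$-jitter $\rho$-response bounded-robust winning if for every prefix $s_0,(m_1^0,m_2^0),\dots,s_k$ with $m_i^j=\langle\Delta_i^j,a_i^j\rangle$, the proposal $m=\langle\Delta,a_1\rangle$ satisfies $\{m+e:e\in[0,\varepsilon]\}\subseteq\Gamma_1(s_k)$ and $\Delta\ge\rho-\sum_{j=q}^{k-1}\Delta^j_{g(j)}$, where $g(j)=1$ if player 1 is blamed for the $j$-th transition and $2$ otherwise, and $q=0$ if in every transition $j<k$ each blamed player $i$ used an action $\bot_i$, while otherwise $q$ is the largest $p\le k$ such that in transition $p-1$ some blamed player $i$ used an action other than $\bot_i$. The jittered outcomes of $\pi_1,\pi_2$ from $s$ are the runs whose next state at each step lies in $\{\delta_{jd}(s_k,m_1+e,m_2):e\in[0,\varepsilon]\}$ for $m_1,m_2$ the proposed moves. $\mathrm{JRWinTimeDiv}_1^{\mathcal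 A,\varepsilon,\rho}(\Phi)$: states from which player 1 has such a compatible strategy, receptive in this semantics, all of whose jittered outcomes against every receptive player-2 strategy lie in $\Phi$. *)

(* Defs.v *)
From HB Require Import structures.
From mathcomp Require Import all_boot all_order all_algebra.
From mathcomp Require Import all_classical all_reals all_analysis.

Set Implicit Arguments.
Unset Strict Implicit.
Unset Printing Implicit Defensive.

Import Order.TTheory GRing.Theory Num.Theory.
Import numFieldNormedType.Exports.

Local Open Scope classical_set_scope.
Local Open Scope ring_scope.

Inductive constraint (C : Type) : Type :=
| Cle (x : C) (d : nat)
| Cge (d : nat) (x : C)
| Cneg (phi : constraint C)
| Cand (phi psi : constraint C).

Record edge (L C A1 A2 : finType) : Type := Edge {
  esrc : L;
  elab : A1 + A2;
  eguard : constraint C;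
  edst : L;
  ereset : {set C} }.

(* Edges are labelled in the disjoint sum of the two action sets; the special
   actions bot_1, bot_2, bot_star are added in [action] below. *)
Record timed_game : Type := TimedGame {
  location : finType;
  clock : finType;
  act1 : finType;
  act2 : finType;
  edges : set (edge location clock act1 act2);
  edges_det : forall e e', edges e -> edges e' ->
    esrc e = esrc e' -> elab e = elab e' -> e = e';
  loc_invariant : location -> constraint clock }.

Inductive action (A : timed_game) : Type :=
| Act (a : act1 A + act2 A)
| Bot1
| Bot2
| BotStar.
Arguments Bot1 {A}.
Arguments Bot2 {A}.
Arguments BotStar {A}.

Section Semantics.
Context {R : realType} {A : timed_game}.

Definition valuation := {ffun clock A -> R}.

Fixpoint sat (k : valuation) (phi : constraint (clock A)) : bool :=
  match phi with
  | Cle x d => k x <= d%:R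
  | Cge d x => d%:R <= k x
  | Cneg phi => ~~ sat k phi
  | Cand phi psi => sat k phi && sat k psi
  end.

Definition delay (k : valuation) (t : R) : valuation := [ffun x => k x + t].

Definition reset (X : {set clock A}) (k : valuation) : valuation :=
  [ffun x => if x \in X then 0 else k x].

Definition is_state (s : location A * valuation) : bool :=
  [forall x, 0 <= s.2 x] && sat s.2 (loc_invariant s.1).

Definition state := {s : location A * valuation | is_state s}.

Definition sloc (s : state) : location A := (val s).1.
Definition sclk (s : state) : valuation := (val s).2.

Definition move := (R * action A)%type.

(* The graph of the transition function: [delta s m s'] reads delta(s,m) = s'.
   By [edges_det] at most one s' is related to given s and m. *)
Definition delta (s : state) (m : move) (s' : state) : Prop :=
  match m.2 with
  | BotStar => s' = s
  | Bot1 | Bot2 => val s' = (sloc s, delay (sclk s) m.1)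
  | Act a => exists e, [/\ edges e, esrc e = sloc s, elab e = a &
      val s' = (edst e, reset (ereset e) (delay (sclk s) m.1))]
  end.

Definition can_wait (s : state) (t : R) : Prop :=
  0 <= t /\ forall t', 0 <= t' <= t -> sat (delay (sclk s) t') (loc_invariant (sloc s)).

(* The last conjunct asks that delta(s,m) be a state, i.e. that the target
   invariant hold after the reset. *)
Definition can_act (s : state) (t : R) (a : act1 A + act2 A) : Prop :=
  [/\ can_wait s t,
      exists e, [/\ edges e, esrc e = sloc s, elab e = a &
                    sat (delay (sclk s) t) (eguard e)]
    & exists s', delta s (t, Act a) s'].

Definition Gamma1 (s : state) : set move := [set m |
  match m.2 with
  | Act (inl a) => can_act s m.1 (inl a)
  | Bot1 => can_wait s m.1
  | BotStar => m.1 = 0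
  | _ => False
  end].

Definition Gamma2 (s : state) : set move := [set m |
  match m.2 with
  | Act (inr a) => can_act s m.1 (inr a)
  | Bot2 => can_wait s m.1
  | _ => False
  end].

Definition delta_jd (s : state) (m1 m2 : move) : set state := [set s' |
  [/\ m1.2 <> BotStar, m1.1 <= m2.1 & delta s m1 s'] \/
  ((m1.2 = BotStar \/ m2.1 <= m1.1) /\ delta s m2 s')].

(* Arbitrary sequences of states and proposed moves; [is_run] singles out runs. *)
Record trace := Trace {
  st : nat -> state;
  mv1 : nat -> move;
  mv2 : nat -> move }.

Definition is_run (r : trace) : Prop := forall k,
  [/\ Gamma1 (st r k) (mv1 r k), Gamma2 (st r k) (mv2 r k) &
      delta_jd (st r k) (mv1 r k) (mv2 r k) (st r k.+1)].

Definition objective := set trace.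

Definition elapsed (r : trace) (k : nat) : R :=
  if `[< (mv1 r k).2 = BotStar >] then (mv2 r k).1
  else Num.min (mv1 r k).1 (mv2 r k).1.

Definition time_divergent (r : trace) : Prop :=
  series (elapsed r) @ \oo --> +oo.

Definition blamed1 (r : trace) (k : nat) : Prop :=
  [/\ (mv1 r k).2 <> BotStar, (mv1 r k).1 <= (mv2 r k).1 &
      delta (st r k) (mv1 r k) (st r k.+1)].

Definition blamed2 (r : trace) (k : nat) : Prop :=
  ((mv2 r k).1 <= (mv1 r k).1 /\ delta (st r k) (mv2 r k) (st r k.+1)) \/
  (mv1 r k).2 = BotStar.

Definition blameless1 (r : trace) : Prop := finite_set [set k | blamed1 r k].
Definition blameless2 (r : trace) : Prop := finite_set [set k | blamed2 r k].

(* s_0,(m_1^0,m_2^0),...,s_k is stored as the list of the (s_j,m_1^j,m_2^j),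
   j < k, together with s_k. Only prefixes of runs matter for strategies; every
   finite valid sequence extends to a run, as both players may wait 0. *)
Definition run_prefix := (seq (state * move * move) * state)%type.

Definition prefix_of (r : trace) (k : nat) : run_prefix :=
  ([seq (st r j, mv1 r j, mv2 r j) | j <- iota 0 k], st r k).

Definition strategy1 (pi : run_prefix -> move) : Prop := forall r k,
  is_run r -> Gamma1 (st r k) (pi (prefix_of r k)).

Definition strategy2 (pi : run_prefix -> move) : Prop := forall r k,
  is_run r -> Gamma2 (st r k) (pi (prefix_of r k)).

(* Runs from s in which player 1's actual move is drawn from a set of moves
   determined by the prefix: a singleton for an ordinary strategy, an interval of
   delays for limit-robust and jittered ones. The run records the actual move. *)
Definition outcomes (c1 : run_prefix -> set move) (pi2 : run_prefix -> move) (s : state) :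
    set trace := [set r |
  [/\ is_run r, st r 0%N = s &
      forall k, c1 (prefix_of r k) (mv1 r k) /\ mv2 r k = pi2 (prefix_of r k)]].

Definition exactly (pi : run_prefix -> move) (p : run_prefix) : set move := [set pi p].

Definition receptive_for1 (c1 : run_prefix -> set move) : Prop :=
  forall pi2, strategy2 pi2 -> forall s r, outcomes c1 pi2 s r ->
    time_divergent r \/ blameless1 r.

Definition receptive2 (pi2 : run_prefix -> move) : Prop :=
  strategy2 pi2 /\
  forall pi1, strategy1 pi1 -> forall s r, outcomes (exactly pi1) pi2 s r ->
    time_divergent r \/ blameless2 r.

Definition wins (c1 : run_prefix -> set move) (Phi : objective) (s : state) : Prop :=
  forall pi2, receptive2 pi2 -> outcomes c1 pi2 s `<=` Phi.

Definition WinTimeDiv1 (Phi : objective) : set state := [set s |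
  exists pi1, [/\ strategy1 pi1, receptive_for1 (exactly pi1) &
                  wins (exactly pi1) Phi s]].

Inductive lr_move : Type :=
| LRstar (t : R)
| LRint (alpha beta : R) (a : action A).

Definition lr_choices (m : lr_move) : set move :=
  match m with
  | LRstar t => [set (t, BotStar)]
  | LRint alpha beta a => [set m | alpha <= m.1 <= beta /\ m.2 = a]
  end.

Definition lr_Gamma1 (s : state) : set lr_move := [set m |
  match m with
  | LRstar _ => True
  | LRint alpha beta _ => 0 <= alpha < beta
  end /\ lr_choices m `<=` Gamma1 s].

Definition lr_strategy1 (pi : run_prefix -> lr_move) : Prop := forall r k,
  is_run r -> lr_Gamma1 (st r k) (pi (prefix_of r k)).

Definition lr_exactly (pi : run_prefix -> lr_move) (p : run_prefix) : set move :=
  lr_choices (pi p).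

Definition RobWinTimeDiv1 (Phi : objective) : set state := [set s |
  exists pi1, [/\ lr_strategy1 pi1, receptive_for1 (lr_exactly pi1) &
                  wins (lr_exactly pi1) Phi s]].

Definition jittered (eps : R) (m : move) : set move :=
  [set (m.1 + e, m.2) | e in [set e : R | 0 <= e <= eps]].

Definition blamed_delay (r : trace) (j : nat) : R :=
  if `[< blamed1 r j >] then (mv1 r j).1 else (mv2 r j).1.

Definition acted (r : trace) (j : nat) : Prop :=
  (blamed1 r j /\ (mv1 r j).2 <> Bot1) \/ (blamed2 r j /\ (mv2 r j).2 <> Bot2).

(* The index q for the prefix ending in s_k; the empty maximum is 0. *)
Definition last_acted (r : trace) (k : nat) : nat :=
  (\max_(j < k | `[< acted r j >]) j.+1)%N.

Definition jr_compatible (eps rho : R) (pi : run_prefix -> move) : Prop := forall r k,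
  is_run r ->
  jittered eps (pi (prefix_of r k)) `<=` Gamma1 (st r k) /\
  rho - \sum_(last_acted r k <= j < k) blamed_delay r j <= (pi (prefix_of r k)).1.

Definition jr_exactly (eps : R) (pi : run_prefix -> move) (p : run_prefix) : set move :=
  jittered eps (pi p).

Definition JRWinTimeDiv1 (eps rho : R) (Phi : objective) : set state := [set s |
  exists pi1, [/\ strategy1 pi1, jr_compatible eps rho pi1,
                  receptive_for1 (jr_exactly eps pi1) &
                  wins (jr_exactly eps pi1) Phi s]].

End Semantics.

Arguments objective : clear implicits.

(* Main.v *)
(* The inclusions. A jittered move <Delta, a> is the limit-robust move
   <[Delta, Delta + eps], a>: the action bot_star cannot occur in a compatible
   strategy, since it only allows the delay 0. The left ends of the intervals of a
   limit-robust strategy form an ordinary strategy with fewer outcomes.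

   Strictness. In a game where the players can only wait, let player 1 win iff its
   first move is <Delta, bot_1> with Delta at most the initial reading x of the
   clock. This is always possible exactly (Delta = 0), possible with an interval of
   delays iff x > 0, and impossible with jitter eps > x. *)
Require Import Defs.
From HB Require Import structures.
From mathcomp Require Import all_boot all_order all_algebra.
From mathcomp Require Import all_classical all_reals all_analysis.
From mathcomp Require Import lra.

Import Order.TTheory GRing.Theory Num.Theory.
Local Open Scope classical_set_scope.
Local Open Scope ring_scope.

(** * Legal moves, run prefixes and existence of outcomes *)

Section Outcomes.
Set Implicit Arguments.
Unset Strict Implicit.
Context {R : realType} {A : timed_game}.
Implicit Types (s : @state R A) (m : @move R A) (Phi : objective R A).

Lemma delay0 (k : @valuation R A) : delay k 0 = k.
Proof. by apply/ffunP => x; rewrite ffunE addr0. Qed.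

Lemma can_wait0 s : can_wait s 0.
Proof.
split=> // t /andP[t0 t1]; have -> : t = 0 by apply/eqP; rewrite eq_le t0 t1.
by rewrite delay0; case/andP: (valP s).
Qed.

Lemma can_wait_delta s t : can_wait s t ->
  exists s' : @state R A, val s' = (sloc s, delay (sclk s) t).
Proof.
move=> [t0 sw].
have st : is_state (sloc s, delay (sclk s) t).
  rewrite /is_state /= sw ?t0 ?lexx // andbT; apply/forallP => x.
  by rewrite ffunE addr_ge0 //; case/andP: (valP s) => /forallP.
by exists (exist is_state _ st).
Qed.

Lemma Gamma1_delta s m : Gamma1 s m -> exists s', delta s m s'.
Proof.
case: m => t [[a|b]|||] //=.
- by case.
- exact: can_wait_delta.
- by exists s.
Qed.

Lemma Gamma2_delta s m : Gamma2 s m -> exists s', delta s m s'.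
Proof.
case: m => t [[a|b]|||] //=.
- by case.
- exact: can_wait_delta.
Qed.

Lemma delta_jd_nonempty s m1 m2 : Gamma1 s m1 -> Gamma2 s m2 ->
  delta_jd s m1 m2 !=set0.
Proof.
move=> /Gamma1_delta[s1 d1] /Gamma2_delta[s2 d2].
have [star|nstar] := pselect (m1.2 = BotStar); first by exists s2; right; split; [left|].
have [le12|/ltW le21] := leP m1.1 m2.1; first by exists s1; left.
by exists s2; right; split; [right|].
Qed.

Lemma Gamma1_ge0 s m : Gamma1 s m -> 0 <= m.1.
Proof. by case: m => t [[a|b]|||] //=; [case; case|case|by rewrite /Gamma1 /= => ->]. Qed.

Lemma Gamma2_ge0 s m : Gamma2 s m -> 0 <= m.1.
Proof. by case: m => t [[a|b]|||] //=; [case; case|case]. Qed.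

Lemma prefix_ofS (r : @trace R A) k :
  prefix_of r k.+1 =
  (rcons (prefix_of r k).1 (st r k, mv1 r k, mv2 r k), st r k.+1).
Proof. by rewrite /prefix_of -addn1 iotaD map_cat /= cats1. Qed.

Definition run_upto (r : @trace R A) k := forall j, (j < k)%N ->
  [/\ Gamma1 (st r j) (mv1 r j), Gamma2 (st r j) (mv2 r j) &
      delta_jd (st r j) (mv1 r j) (mv2 r j) (st r j.+1)].

(** Strategies are constrained only on prefixes of full runs. Letting both players wait 0 from step
    [k] on turns a valid finite part into a run with the same prefix. *)
Lemma run_upto_extend (r : @trace R A) k : run_upto r k ->
  exists r', is_run r' /\ prefix_of r' k = prefix_of r k.
Proof.
move=> rk; pose r' := Trace (fun j => st r (minn j k))
  (fun j => if (j < k)%N then mv1 r j else (0, Bot1))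
  (fun j => if (j < k)%N then mv2 r j else (0, Bot2)).
exists r'; split=> [j|].
  rewrite /=; have [jk|kj] := ltnP j k.
    by rewrite (minn_idPl jk); exact: rk.
  rewrite (minn_idPr (leqW kj)).
  split; [exact: can_wait0|exact: can_wait0|left; split=> //=].
  by rewrite /delta /= delay0; exact: surjective_pairing.
rewrite /prefix_of /= minnn; congr pair; apply/eq_in_map => j.
by rewrite mem_iota add0n /= => jk; rewrite jk (minn_idPl (ltnW jk)).
Qed.

(** Iterate the proposals. By induction each finite part is valid, hence extends to a run; so the
    next proposals are legal, and legal moves have a joint successor, which [xget] picks. *)
Lemma outcomes_exactly_nonempty pi1 pi2 s : strategy1 pi1 -> strategy2 pi2 ->
  outcomes (exactly pi1) pi2 s !=set0.
Proof.
move=> str1 str2.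
pose next (p : @run_prefix R A) : run_prefix :=
  (rcons p.1 (p.2, pi1 p, pi2 p), xget p.2 (delta_jd p.2 (pi1 p) (pi2 p))).
pose P k := iter k next ([::], s).
pose r := Trace (fun k => (P k).2) (fun k => pi1 (P k)) (fun k => pi2 (P k)).
have Pr k : prefix_of r k = P k.
  by elim: k => [//|k IHk]; rewrite prefix_ofS IHk.
have rk k : run_upto r k.
  elim: k => [//|k IHk] j; rewrite ltnS leq_eqVlt => /predU1P[->|]; last exact: IHk.
  have [r' [runr' pr']] := run_upto_extend IHk.
  have str' : st r' k = st r k by case: pr'.
  have G1 := str1 _ k runr'; have G2 := str2 _ k runr'.
  rewrite pr' Pr str' in G1 G2.
  split=> //; case: (delta_jd_nonempty G1 G2) => s' ds'.
  exact: (@xgetPex _ (P k).2 _ (ex_intro _ s' ds')).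
exists r; split=> // [k|k]; first exact: (rk k.+1).
by rewrite Pr.
Qed.

(** * Comparison of strategies by their outcomes, and the two inclusions *)

Definition refines (c c' : @run_prefix R A -> set (@move R A)) := forall r k,
  is_run r -> c (prefix_of r k) `<=` c' (prefix_of r k).

Lemma outcomes_refines c c' pi2 s :
  refines c c' -> outcomes c pi2 s `<=` outcomes c' pi2 s.
Proof.
by move=> cc' r [rr ? H]; split=> // k; have [ck ?] := H k; split=> //; exact: cc' ck.
Qed.

Lemma receptive_for1_refines c c' :
  refines c c' -> receptive_for1 c' -> receptive_for1 c.
Proof. by move=> cc' rc pi2 s2 s r /(outcomes_refines cc'); exact: rc. Qed.

Lemma wins_refines c c' Phi s : refines c c' -> wins c' Phi s -> wins c Phi s.
Proof. by move=> cc' wc pi2 r2 r /(outcomes_refines cc'); exact: wc. Qed.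

Lemma JRWin_sub_RobWin Phi (eps rho : R) : 0 < eps ->
  JRWinTimeDiv1 eps rho Phi `<=` RobWinTimeDiv1 Phi.
Proof.
move=> eps0 s [pi [str cpt rec win]].
pose pi' (p : @run_prefix R A) := LRint (pi p).1 ((pi p).1 + eps) (pi p).2.
have pi'E : lr_exactly pi' = jr_exactly eps pi.
  apply/funext => p.
  apply/seteqP; split=> [[t a] [/= /andP[t0 t1] ->]|_ [e /= /andP[e0 e1] <-]] /=.
    by exists (t - (pi p).1) => /=; [apply/andP; split; lra|congr pair; lra].
  by split=> //=; rewrite lerDl lerD2l e0.
exists pi'; rewrite pi'E; split=> // r k rr; have [jit _] := cpt r k rr; split.
  by rewrite /= (Gamma1_ge0 (str r k rr)) ltrDl.
by change (lr_exactly pi' (prefix_of r k) `<=` Gamma1 (st r k)); rewrite pi'E.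
Qed.

Definition left_end (m : @lr_move R A) : move :=
  match m with LRstar t => (t, BotStar) | LRint a _ act => (a, act) end.

(** The selection that refutes winning: the right end of an interval is strictly positive. *)
Definition right_end (m : @lr_move R A) : move :=
  match m with LRstar t => (t, BotStar) | LRint _ b act => (b, act) end.

Lemma lr_Gamma1_left_end s (m : @lr_move R A) : lr_Gamma1 s m -> lr_choices m (left_end m).
Proof. by case: m => [t|a b act] [//= /andP[_ /ltW ab] _]; rewrite lexx. Qed.

Lemma lr_Gamma1_right_end s (m : @lr_move R A) : lr_Gamma1 s m -> lr_choices m (right_end m).
Proof. by case: m => [t|a b act] [//= /andP[_ /ltW ab] _]; rewrite lexx ab. Qed.

Lemma RobWin_sub_Win Phi : RobWinTimeDiv1 Phi `<=` WinTimeDiv1 Phi.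
Proof.
move=> s [pi [str rec win]].
have ref : refines (exactly (left_end \o pi)) (lr_exactly pi).
  by move=> r k rr m ->; exact: lr_Gamma1_left_end (str r k rr).
exists (left_end \o pi); split.
- by move=> r k rr; have [_] := str r k rr; apply; exact: ref.
- exact: receptive_for1_refines rec.
- exact: wins_refines win.
Qed.

(** * Criteria for receptiveness *)

Lemma blamed_once_blameless1 (r : @trace R A) :
  (forall k, (mv1 r k.+1).2 = BotStar) -> blameless1 r.
Proof.
move=> star; apply: (@sub_finite_set _ _ [set 0%N]) => //.
by move=> [//|k] [/=]; rewrite star.
Qed.

(** Partial sums are nondecreasing, so they diverge to infinity unless they converge; convergence
    would push the terms below 1 eventually. *)
Lemma series_pinfty_infinitely_often_ge1 (u : R ^nat) : (forall k, 0 <= u k) ->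
  ~ finite_set [set k | 1 <= u k] -> series u @ \oo --> +oo.
Proof.
move=> u0 inf; apply: nondecreasing_dvgn_lt.
  by apply/nondecreasing_seqP => n; rewrite seriesSr lerDl.
move=> /cvg_series_cvg_0 /cvgr_lt /(_ 1 ltr01) [N _ uN].
apply: inf; apply: (@sub_finite_set _ _ `I_N) => [k /= uk|]; last exact: finite_II.
by rewrite ltnNge; apply/negP => /uN /=; rewrite ltNge uk.
Qed.

Lemma elapsed_ge0 (r : @trace R A) k : is_run r -> 0 <= elapsed r k.
Proof.
move=> /(_ k)[/Gamma1_ge0 g1 /Gamma2_ge0 g2 _].
by rewrite /elapsed; case: ifP => // _; rewrite le_min g1.
Qed.

Lemma blamed2_elapsed (r : @trace R A) k : blamed2 r k -> elapsed r k = (mv2 r k).1.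
Proof.
by rewrite /elapsed; case: asboolP => // nstar [[le21 _]|//]; apply/min_idPr.
Qed.

(** A step blamed on player 2 lasts its whole delay, at least 1, so infinitely many such steps make
    time diverge. *)
Lemma delay_ge1_receptive2 pi2 : strategy2 pi2 ->
  (forall p : @run_prefix R A, 1 <= (pi2 p).1) -> receptive2 pi2.
Proof.
move=> str ge1; split=> // pi1 _ s r [rr _ rE].
have [fin|inf] := pselect (finite_set [set k | blamed2 r k]); [by right|left].
apply: series_pinfty_infinitely_often_ge1 => [k|fin]; first exact: elapsed_ge0.
apply: inf; apply: sub_finite_set fin => k /= /blamed2_elapsed ->.
by have [_ ->] := rE k.
Qed.

End Outcomes.

(* One location, one clock, no edges and a trivial invariant: all that a player
   ever chooses is how long to wait. *)
Definition idle_edges : set (edge unit unit void void) := set0.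

Lemma idle_edges_det e e' : idle_edges e -> idle_edges e' ->
  esrc e = esrc e' -> elab e = elab e' -> e = e'.
Proof. by []. Qed.

Definition idle_game : timed_game :=
  TimedGame idle_edges_det (fun=> Cge 0 tt).

Section IdleGame.
Set Implicit Arguments.
Unset Strict Implicit.
Context {R : realType}.
Notation state := (@state R idle_game).
Notation run_prefix := (@run_prefix R idle_game).

Definition reading (s : state) : R := sclk s tt.

Lemma reading_ge0 (s : state) : 0 <= reading s.
Proof. by case/andP: (valP s) => /forallP/(_ tt). Qed.

Lemma state_of_reading (x : R) : 0 <= x -> exists s : state, reading s = x.
Proof.
move=> x0; pose k : @valuation R idle_game := [ffun=> x].
have sk : is_state (tt : location idle_game, k).
  by rewrite /is_state /= ffunE x0 andbT; apply/forallP => y; rewrite ffunE.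
by exists (exist is_state _ sk); rewrite /reading /sclk /= ffunE.
Qed.

Lemma idle_can_wait (s : state) t : 0 <= t -> can_wait s t.
Proof.
move=> t0; split=> // t' /andP[t'0 _] /=; rewrite ffunE addr_ge0 //.
exact: reading_ge0.
Qed.

Definition small_first_delay : objective R idle_game := [set r |
  (mv1 r 0).2 = Bot1 /\ (mv1 r 0).1 <= reading (st r 0)].

(** A concrete receptive opponent, which keeps [wins] from holding vacuously. *)
Definition wait1 (p : run_prefix) : @move R idle_game := (1, Bot2).

Lemma wait1_receptive2 : receptive2 wait1.
Proof.
by apply: delay_ge1_receptive2 => [r k _|p]; [exact: idle_can_wait|exact: lexx].
Qed.

(** Playing the selection [f] against [wait1] yields an outcome of [c] whose first move is that of
    [f]; the objective then bounds this move. *)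
Lemma wins_first_move (c : run_prefix -> set move) (f : run_prefix -> move)
    (s : state) :
  strategy1 f -> refines (exactly f) c -> wins c small_first_delay s ->
  (f ([::], s)).2 = Bot1 /\ (f ([::], s)).1 <= reading s.
Proof.
move=> strf ref win.
have [r out] := outcomes_exactly_nonempty s strf wait1_receptive2.1.
have [] := win _ wait1_receptive2 _ (outcomes_refines ref out).
have [_ r0 /(_ 0%N)[-> _]] := out.
by rewrite /prefix_of /= r0.
Qed.

(** * The three winning sets for [small_first_delay] *)

Lemma JRWin_small_first_delay (eps rho : R) (s : state) : 0 <= eps ->
  JRWinTimeDiv1 eps rho small_first_delay s -> eps <= reading s.
Proof.
move=> eps0 [pi [str cpt rec win]].
(* Maximal jitter makes the first delay at least [eps]. *)
pose f (p : run_prefix) := ((pi p).1 + eps, (pi p).2).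
have ref : refines (exactly f) (jr_exactly eps pi).
  by move=> r k rr m ->; exists eps => //=; rewrite eps0 lexx.
have strf : strategy1 f.
  by move=> r k rr; have [jit _] := cpt r k rr; apply: jit; exact: ref.
have [_] := wins_first_move strf ref win; apply: le_trans; rewrite lerDr.
(* Some run from [s] is needed to know that the first proposal is legal, hence has a nonnegative
   delay. *)
have [r [rr r0 _]] := outcomes_exactly_nonempty s strf wait1_receptive2.1.
by have /Gamma1_ge0 := str r 0%N rr; rewrite /prefix_of /= r0.
Qed.

Lemma RobWin_small_first_delay (s : state) :
  RobWinTimeDiv1 small_first_delay s <-> 0 < reading s.
Proof.
split=> [[pi [str rec win]]|s0].
  have ref : refines (exactly (right_end \o pi)) (lr_exactly pi).
    by move=> r k rr m ->; exact: lr_Gamma1_right_end (str r k rr).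
  have strf : strategy1 (right_end \o pi).
    by move=> r k rr; have [_] := str r k rr; apply; exact: ref.
  have [] := wins_first_move strf ref win.
  have [r [rr r0 _]] := outcomes_exactly_nonempty s strf wait1_receptive2.1.
  have := str r 0%N rr; rewrite /prefix_of /= r0.
  case: (pi _) => [//|a b act] [/= /andP[a0 ab] _] _.
  by apply: lt_le_trans; exact: le_lt_trans ab.
(* Legality is required from every state, and at reading 0 the interval would be degenerate; hence
   the test on the reading. *)
pose pi (p : run_prefix) : @lr_move R idle_game :=
  if nilp p.1 && (0 < reading p.2) then LRint 0 (reading p.2) Bot1 else LRstar 0.
exists pi; split.
- move=> r k rr; rewrite /pi /=; case: ifP => [/andP[_ rd0]|_]; split=> //=.
  + by rewrite lexx.
  + by case=> t a /= [/andP[t0 _] ->]; exact: idle_can_wait.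
  + by move=> _ ->.
- move=> pi2 _ s' r [rr _ rE]; right; apply: blamed_once_blameless1 => k.
  by have [] := rE k.+1; rewrite prefix_ofS /lr_exactly /pi /nilp size_rcons /= => ->.
- move=> pi2 _ r [rr r0 rE]; have [] := rE 0%N.
  by rewrite /lr_exactly /pi /= r0 s0 /= => -[/andP[_ ?] ?] _; split=> //; rewrite r0.
Qed.

Lemma Win_small_first_delay (s : state) : WinTimeDiv1 small_first_delay s.
Proof.
(* Repeating the move with delay 0 and [Bot1] could be blamed forever while no time passes;
   [BotStar] after the first step ensures receptiveness. *)
pose pi (p : run_prefix) : @move R idle_game :=
  (0, if nilp p.1 then Bot1 else BotStar).
exists pi; split.
- by move=> r k rr; rewrite /pi; case: ifP => _ //; exact: can_wait0.
- move=> pi2 _ s' r [rr _ rE]; right; apply: blamed_once_blameless1 => k.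
  by have [] := rE k.+1; rewrite prefix_ofS /exactly /pi /nilp size_rcons /= => ->.
- move=> pi2 _ r [rr r0 rE]; have [m0 _] := rE 0%N.
  by rewrite /exactly /pi /= in m0; split; rewrite m0 //=; exact: reading_ge0.
Qed.

End IdleGame.

Theorem theorem4p10 (R : realType) :
  (forall (A : timed_game) (Phi : objective R A) (eps rho : R), 0 < eps -> 0 <= rho ->
     JRWinTimeDiv1 eps rho Phi `<=` RobWinTimeDiv1 Phi /\
     RobWinTimeDiv1 Phi `<=` WinTimeDiv1 Phi) /\
  (exists (A : timed_game) (Phi : objective R A), forall eps rho : R, 0 < eps -> 0 <= rho ->
     JRWinTimeDiv1 eps rho Phi `<` RobWinTimeDiv1 Phi /\
     RobWinTimeDiv1 Phi `<` WinTimeDiv1 Phi).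
Proof.
split=> [A Phi eps rho eps0 _|].
  by split; [exact: JRWin_sub_RobWin|exact: RobWin_sub_Win].
exists idle_game, small_first_delay => eps rho eps0 _; split; split.
- exact: JRWin_sub_RobWin.
(* The reading [eps / 2] is positive, so robustly winning, but below [eps]. *)
- have [|s sE] := @state_of_reading R (eps / 2); first by rewrite divr_ge0 ?ltW.
  move=> /(_ s); rewrite RobWin_small_first_delay sE divr_gt0 // => /(_ isT).
  by move=> /(JRWin_small_first_delay (ltW eps0)); rewrite sE; lra.
- exact: RobWin_sub_Win.
(* At reading 0 only the exact delay 0 meets the objective. *)
- have [s sE] := state_of_reading (lexx (0 : R)).
  move=> /(_ s (Win_small_first_delay s)).
  by rewrite RobWin_small_first_delay sE ltxx.
Qed.
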